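(* Let $\zeta_1,\dots,\zeta_N$ be points in the unit disc $\mathbb{B}^2$. Then there exists a unique (up to a rotation) Möbius transformation of the form $$g_c(z)=e^{i\theta}\frac{c-z}{1-\bar c z},\qquad \theta\in[0,2\pi),\ c\in\mathbb{B}^2,$$ such that $$\sum_{k=1}^N g_c(\zeta_k)=0.$$
   Context: $\mathbb{B}^2=\{z\in\mathbb{C}: |z|<1\}$ is the open unit disc. $N\ge 1$ is an integer. ''Unique up to a rotation'' means that the parameter $c\in\mathbb{B}^2$ is unique, while $\theta$ is arbitrary. *)

(* Defs.v *)
From mathcomp Require Import all_boot all_order all_algebra.
From mathcomp Require Import complex.
From mathcomp Require Import classical_sets reals trigo.

Set Implicit Arguments.
Unset Strict Implicit.
Unset Printing Implicit Defensive.

Import Order.TTheory GRing.Theory Num.Theory.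

Local Open Scope ring_scope.
Local Open Scope complex_scope.
Local Open Scope classical_set_scope.

(* The norm of [R[i]] takes its values in [R[i]] (as reals), and [x < y] there
   means that [y - x] is a positive real; so [`|z| < 1] is the usual condition
   on the modulus. *)
Definition unit_disc (R : realType) : set R[i] := [set z | `|z| < 1].

(* [expi theta] is e^{i theta}. *)
Definition expi (R : realType) (theta : R) : R[i] := cos theta +i* sin theta.

Definition mobius (R : realType) (theta : R) (c z : R[i]) : R[i] :=
  expi theta * ((c - z) / (1 - c^* * z)).

(* Main.v *)
(* Write g_c(z) = (c - z) / (1 - c^* z).
   Existence: c |-> \prod_k (1 - |c|^2) / |1 - c^* zeta_k|^2 is continuous on the
   closed disc, positive inside and zero on the boundary, hence has an interior
   maximum c; the vanishing of its logarithmic derivative there reads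
   \sum_k g_c(zeta_k) = 0.
   Uniqueness: if d is another solution, put w_k = g_c(zeta_k) and a = g_c(d).
   Since g_a o g_c is g_d up to a unimodular factor, \sum_k w_k = 0 and
   \sum_k g_a(w_k) = 0.  With u_k = a^* w_k, the real part of
   (|a|^2 - u_k) / (1 - u_k) + u_k = a^* (g_a(w_k) + w_k) is positive unless
   a = 0, so a = 0 and d = c. *)
Require Import Defs.
From mathcomp Require Import all_boot all_order all_algebra.
From mathcomp Require Import complex.
From mathcomp Require Import classical_sets reals trigo.
From mathcomp Require Import boolp topology normedtype derive.
From mathcomp Require Import ring lra.

Set Implicit Arguments.
Unset Strict Implicit.
Unset Printing Implicit Defensive.

Import Order.TTheory GRing.Theory Num.Theory.
Import numFieldNormedType.Exports.

Local Open Scope ring_scope.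
Local Open Scope complex_scope.
Local Open Scope classical_set_scope.

Section DiscBalancing.
Variable R : realType.
Implicit Types z c : R[i].

(** * Squared modulus on the disc *)

(** Real-valued, unlike the norm of [R[i]], and polynomial in the coordinates, so that [ring],
    [field] and [nra] apply. *)
Definition sqnorm z : R := complex.Re z ^+ 2 + complex.Im z ^+ 2.

Lemma sqnorm_ge0 z : 0 <= sqnorm z.
Proof. by rewrite addr_ge0 ?sqr_ge0. Qed.

Lemma sqnorm_eq0 z : (sqnorm z == 0) = (z == 0).
Proof. by rewrite eq_complex paddr_eq0 ?sqr_ge0 // !sqrf_eq0. Qed.

Lemma sqnorm_gt0 z : (0 < sqnorm z) = (z != 0).
Proof. by rewrite lt0r sqnorm_eq0 sqnorm_ge0 andbT. Qed.

Lemma sqnormM z z' : sqnorm (z * z') = sqnorm z * sqnorm z'.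
Proof. by case: z z' => [x y] [x' y']; rewrite /sqnorm /=; ring. Qed.

Lemma sqnormJ z : sqnorm z^*%R = sqnorm z.
Proof. by case: z => x y; rewrite /sqnorm /= sqrrN. Qed.

Lemma unit_discE z : unit_disc z <-> sqnorm z < 1.
Proof.
rewrite /unit_disc /= normc_def ltcE /= eqxx /= -[X in _ < X]sqrtr1.
by rewrite ltr_sqrt.
Qed.

(** The product has modulus below 1. Allowing [c] on the unit circle gives continuity of the
    potential up to the boundary. *)
Lemma one_sub_conjM_neq0 c z :
  sqnorm c <= 1 -> sqnorm z < 1 -> 1 - c^* * z != 0.
Proof.
move=> c1 z1; apply/eqP => /eqP; rewrite subr_eq0 => /eqP e.
have : sqnorm (c^* * z) < 1.
  by rewrite sqnormM sqnormJ (le_lt_trans _ z1)// ler_piMl// sqnorm_ge0.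
by rewrite -e /sqnorm /= expr0n addr0 expr1n ltxx.
Qed.

(** * Derivatives of real polynomials and limits of finite products *)

Lemma poly_local_min (p : {poly R}) :
  (\forall t \near 0, p.[0] <= p.[t]) -> p^`().[0] = 0.
Proof.
move=> /nbhs_ballP[/= e e0 pmin].
have /= h : is_derive (0 : R) 1 (horner p) 0.
  apply: (@derive1_at_min R _ (- e) e) => [|t _| |t].
  - by rewrite -subr_ge0 opprK addr_ge0 ?ltW.
  - exact: derivable_horner.
  - by rewrite in_itv /= oppr_lt0 e0.
  - rewrite in_itv /= => te; apply: pmin.
    by rewrite /ball /= sub0r normrN ltr_norml.
by rewrite derivE derive1E derive_val.
Qed.

Lemma deriv_prod_horner (n : nat) (p : 'I_n -> {poly R}) (x : R) :
  (forall k, (p k).[x] != 0) ->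
  (\prod_k p k)^`().[x] =
  (\prod_k (p k).[x]) * \sum_k (p k)^`().[x] / (p k).[x].
Proof.
elim: n p => [|n IH] p p0; first by rewrite !big_ord0 derivC horner0 mulr0.
rewrite !big_ord_recl derivM hornerD !hornerM IH// horner_prod.
by field; exact: p0.
Qed.

(** Restricted to the real line [z + t v], the squared modulus becomes a polynomial in [t], to which
    formal derivatives apply. *)
Definition sqnorm_line z v : {poly R} :=
  ((complex.Re z)%:P + (complex.Re v)%:P * 'X) ^+ 2 +
  ((complex.Im z)%:P + (complex.Im v)%:P * 'X) ^+ 2.

Lemma sqnorm_lineE z v t : (sqnorm_line z v).[t] = sqnorm (z + t%:C * v).
Proof. by case: z v => x y [p q]; rewrite /sqnorm_line /sqnorm !hornerE /=; ring. Qed.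

Lemma deriv_sqnorm_line z v :
  (sqnorm_line z v)^`().[0] = 2 * complex.Re (v^* * z).
Proof.
case: z v => x y [p q]; rewrite /sqnorm_line /= !(poly.derivE, hornerE) /=.
by ring.
Qed.

Lemma cvg_prod_ord (T : Type) (F : set_system T) {FF : Filter F} (n : nat)
    (f : 'I_n -> T -> R) (l : 'I_n -> R) :
  (forall k, f k x @[x --> F] --> l k) ->
  (\prod_k f k x) @[x --> F] --> \prod_k l k.
Proof.
elim: n f l => [|n IH] f l fl.
  by under eq_fun do rewrite big_ord0; rewrite big_ord0; exact: cvg_cst.
under eq_fun do rewrite big_ord_recl.
by rewrite big_ord_recl; apply: cvgM; [|apply: IH => k].
Qed.

(** * Existence: maximizing the potential over the disc *)

Section Potential.
Variables (n : nat) (zeta : 'I_n -> R[i]).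
Hypothesis zeta1 : forall k, sqnorm (zeta k) < 1.

(* By [1 - |g_c(z)|^2 = (1 - |c|^2) (1 - |z|^2) / |1 - c^* z|^2], maximizing this
   amounts to maximizing [\prod_k (1 - |g_c(zeta_k)|^2)]. *)
Definition potential c : R :=
  \prod_k ((1 - sqnorm c) / sqnorm (1 - c^* * zeta k)).

Lemma exists_potential_max : (0 < n)%N ->
  exists2 c, sqnorm c < 1 & forall d, sqnorm d < 1 -> potential d <= potential c.
Proof.
move=> n0.
(* The closed disc is viewed in [R * R], as a closed subset of a compact square. *)
pose toC (p : R * R) : R[i] := p.1 +i* p.2.
pose A := [set p : R * R | sqnorm (toC p) <= 1].
have cfst (p : R * R) : {for p, continuous (fst : R * R -> R)} by exact: cvg_fst.
have csnd (p : R * R) : {for p, continuous (snd : R * R -> R)} by exact: cvg_snd.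
have csqnorm : continuous (sqnorm \o toC).
  have -> : sqnorm \o toC = (fun p => p.1 * p.1 + p.2 * p.2).
    by apply/funext => p; rewrite /sqnorm /= !expr2.
  by move=> p; apply: cvgD; apply: cvgM; solve [exact: cfst|exact: csnd].
have Acpt : compact A.
  have -> : A = (`[-1, 1] `*` `[-1, 1]) `&` A.
    apply/seteqP; split => [[x y] /= xy1|[x y] []//]; split => //.
    move: xy1; rewrite /A /= /sqnorm /= !in_itv /= => xy1.
    by split; apply/andP; split; nra.
  apply: compact_closedI.
    by apply: compact_setX; exact: segment_compact.
  by apply: (preimage_closed _ (@closed_le R 1)) => p _; exact: csqnorm.
have cpot : {within A, continuous (potential \o toC)}.
  apply: continuous_in_subspaceT => p; rewrite inE => Ap.
  rewrite /potential /=.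
  have cE k : {for p, continuous
      (fun q : R * R => (1 - sqnorm (toC q)) / sqnorm (1 - (toC q)^* * zeta k))}.
    apply: cvgM; first by apply: cvgB; [exact: cvg_cst|exact: csqnorm].
    apply: cvgV.
      by rewrite sqnorm_eq0 one_sub_conjM_neq0.
    case: (zeta k) => a b; rewrite /sqnorm /=.
    by apply: cvgD; apply: cvgM; repeat
      first [apply: cvgD | apply: cvgB | apply: cvgM | apply: cvgN
            | exact: cvg_cst | exact: cfst | exact: csnd].
  exact: cvg_prod_ord.
have A0 : A (0, 0) by rewrite /A /= /sqnorm /= expr0n addr0 ler01.
have [|p Ap pmax] := compact_EVT_max _ Acpt cpot; first by exists (0, 0).
exists (toC p).
  (* The maximum is at least the value at the origin, whereas every factor vanishes on the unit
     circle; [n0] supplies a factor. *)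
  have : 0 < potential (toC p).
    apply: lt_le_trans (pmax (0, 0) _); last by rewrite inE.
    by apply: prodr_gt0 => k _; rewrite divr_gt0 ?sqnorm_gt0 ?one_sub_conjM_neq0 //
      /sqnorm /= expr0n /= addr0 ?subr0 ?ler01.
  move: Ap; rewrite inE /A /= le_eqVlt => /orP[/eqP p1|//].
  by rewrite /potential p1 subrr (bigD1 (Ordinal n0))//= !mul0r !ltxx.
move=> [x y] d1; apply: (pmax (x, y)).
by rewrite inE /A /= ltW.
Qed.

Lemma potential_max_critical c : sqnorm c < 1 ->
  (forall d, sqnorm d < 1 -> potential d <= potential c) ->
  \sum_k (c - zeta k) / (1 - c^* * zeta k) = 0.
Proof.
move=> c1 cmax; set S := \sum_k _.
(* Stationarity in every direction [v]; the choice [v = S] gives [|S|^2 = 0]. *)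
suff SS v : complex.Re (v^* * S) = 0.
  apply/eqP; rewrite -sqnorm_eq0; apply/eqP; rewrite -(SS S).
  by case: (S) => x y; rewrite /sqnorm /=; ring.
(* At [c + t v] the potential is [Q(t)^n / \prod_k P_k(t)]; cross-multiplying keeps everything
   polynomial. *)
pose Q : {poly R} := 1 - sqnorm_line c v.
pose P k := sqnorm_line (1 - c^* * zeta k) (- v^* * zeta k).
have Q0 : Q.[0] = 1 - sqnorm c.
  by rewrite /Q hornerD hornerN hornerC sqnorm_lineE mul0r addr0.
have P0 k : (P k).[0] = sqnorm (1 - c^* * zeta k).
  by rewrite /P sqnorm_lineE mul0r addr0.
have Q0_gt0 : 0 < Q.[0] by rewrite Q0 subr_gt0.
have P0_gt0 k : 0 < (P k).[0].
  by rewrite P0 sqnorm_gt0 one_sub_conjM_neq0// ltW.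
(* Maximality says that [h >= 0 = h(0)] near 0, so [h'(0) = 0]. *)
pose h := Q.[0] ^+ n *: \prod_k P k - (\prod_k (P k).[0]) *: \prod_(k < n) Q.
have h0 : h.[0] = 0.
  rewrite /h hornerD hornerN !hornerZ !horner_prod prodr_const card_ord.
  by ring.
have : h^`().[0] = 0.
  apply: poly_local_min; rewrite h0.
  (* Positivity of [Q] keeps [c + t v] in the open disc, where maximality applies. *)
  have near_Q : \forall t \near (0 : R), 0 < Q.[t].
    exact: (cvgr_gt _ (@continuous_horner R Q (0 : R))).
  apply: filterS near_Q => t Qt.
  rewrite /h hornerD hornerN !hornerZ !horner_prod prodr_const card_ord.
  have dE : 1 - sqnorm (c + t%:C * v) = Q.[t].
    by rewrite /Q hornerD hornerN hornerC sqnorm_lineE.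
  have PE k : sqnorm (1 - (c + t%:C * v)^* * zeta k) = (P k).[t].
    have -> : (c + t%:C * v)^*%R = c^*%R + t%:C * v^*.
      by rewrite rmorphD rmorphM; congr (_ + _ * _); exact: conjc_real.
    by rewrite /P sqnorm_lineE; congr sqnorm; ring.
  have d1 : sqnorm (c + t%:C * v) < 1 by rewrite -subr_gt0 dE.
  have Pt_gt0 : 0 < \prod_k (P k).[t].
    apply: prodr_gt0 => k _; rewrite -PE sqnorm_gt0 one_sub_conjM_neq0//.
    exact: ltW.
  have := cmax _ d1; rewrite /potential dE -Q0.
  under eq_bigr do rewrite PE.
  under [X in _ <= X]eq_bigr do rewrite -P0.
  rewrite !prodf_div !prodr_const card_ord ler_pdivrMr// mulrAC.
  rewrite ler_pdivlMr ?prodr_gt0// => hle.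
  by rewrite subr_ge0 mulrC.
(* Once the common positive factor is removed, the sum of [P_k'/P_k - Q'/Q] at 0 remains. *)
rewrite /h derivB !derivZ hornerD hornerN !hornerZ.
rewrite !deriv_prod_horner ?prodr_const ?card_ord; last 2 first.
- by move=> ?; rewrite gt_eqF.
- by move=> ?; rewrite gt_eqF.
rewrite mulrCA -mulrBr -mulrBr -sumrB => /eqP.
have P0_prod_gt0 : 0 < \prod_k (P k).[0] by exact: prodr_gt0.
rewrite mulf_eq0 gt_eqF//= mulf_eq0 expf_eq0 (gt_eqF Q0_gt0) andbF /=.
(* This rests on [c - (1 - |c|^2) z / (1 - c^* z) = (c - z) / (1 - c^* z)]. *)
rewrite (eq_bigr (fun k => 2 / Q.[0] *
   complex.Re (v^* * ((c - zeta k) / (1 - c^* * zeta k))))).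
  rewrite -mulr_sumr mulf_eq0 gt_eqF ?divr_gt0//= => /eqP <-.
  by rewrite mulr_sumr raddf_sum.
have dQ : Q^`().[0] = - (2 * complex.Re (v^* * c)).
  by rewrite /Q derivB derivC sub0r hornerN deriv_sqnorm_line.
move=> k _; rewrite dQ P0 Q0 deriv_sqnorm_line.
move: (P0_gt0 k) Q0_gt0; rewrite P0 Q0.
case: (c) (v) (zeta k) => x y [p q] [a b]; rewrite /sqnorm /= => P0' Q0'.
by field; move: P0'; rewrite sub0r => P0'; rewrite !gt_eqF.
Qed.
End Potential.

(** * Uniqueness: moving one solution to the origin *)

(** For [u = x + iy], multiplying by [|1 - u|^2] leaves [(r - |u|^2) (1 - x) + 2 y^2], where
    [x < 1]. It serves with [r = |a|^2] and [u = a^* w_k]. *)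
Lemma Re_blaschke_gt0 (r : R) (u : R[i]) : sqnorm u < r -> r < 1 ->
  0 < complex.Re ((r%:C - u) / (1 - u) + u).
Proof.
case: u => x y; rewrite /sqnorm /= => ur r1.
have x1 : 0 < 1 - x by nra.
have D0 : 0 < (1 - x) ^+ 2 + y ^+ 2 by nra.
rewrite [X in _ < X](_ : _ = ((r - (x ^+ 2 + y ^+ 2)) * (1 - x) + 2 * y ^+ 2) /
  ((1 - x) ^+ 2 + y ^+ 2)).
  apply: divr_gt0 => //; apply: ltr_pwDl; last by rewrite mulr_ge0 ?sqr_ge0.
  by rewrite mulr_gt0// subr_gt0.
by field; rewrite gt_eqF.
Qed.

Lemma sqnorm_conj z : (sqnorm z)%:C = z^* * z.
Proof.
by case: z => x y; apply/eqP; rewrite eq_complex /sqnorm /=; apply/andP; split;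
  apply/eqP; ring.
Qed.

Lemma balanced_unique n (w : 'I_n -> R[i]) a : (0 < n)%N ->
  (forall k, sqnorm (w k) < 1) -> sqnorm a < 1 -> \sum_k w k = 0 ->
  \sum_k (a - w k) / (1 - a^* * w k) = 0 -> a = 0.
Proof.
move=> n0 w1 a1 w0 aw0; apply/eqP; apply: contraTT isT => a0.
pose u k := a^* * w k.
(* By the two balance conditions this same sum is zero, a contradiction. *)
have : 0 < complex.Re (\sum_k (((sqnorm a)%:C - u k) / (1 - u k) + u k)).
  rewrite raddf_sum /=.
  have u_gt0 k : 0 < complex.Re (((sqnorm a)%:C - u k) / (1 - u k) + u k).
    by apply: Re_blaschke_gt0 => //; rewrite sqnormM sqnormJ gtr_pMr ?sqnorm_gt0.
  rewrite (bigD1 (Ordinal n0))//= ltr_pwDl// sumr_ge0// => k _.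
  exact: ltW.
rewrite big_split /= -mulr_sumr w0 mulr0 addr0.
rewrite (eq_bigr (fun k => a^* * ((a - w k) / (1 - a^* * w k)))).
  by rewrite -mulr_sumr aw0 mulr0 ltxx.
by move=> k _; rewrite sqnorm_conj /u -mulrBr mulrA.
Qed.

Definition blaschke c z : R[i] := (c - z) / (1 - c^* * z).

Lemma sqnorm_blaschke_lt1 c z :
  sqnorm c < 1 -> sqnorm z < 1 -> sqnorm (blaschke c z) < 1.
Proof.
move=> c1 z1; have d0 := one_sub_conjM_neq0 (ltW c1) z1.
have : sqnorm (blaschke c z) * sqnorm (1 - c^* * z) < sqnorm (1 - c^* * z).
  rewrite -sqnormM divfK// -subr_gt0.
  have -> : sqnorm (1 - c^* * z) - sqnorm (c - z) = (1 - sqnorm c) * (1 - sqnorm z).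
    by case: (c) (z) => x y [p q]; rewrite /sqnorm /=; ring.
  by rewrite mulr_gt0// subr_gt0.
by rewrite gtr_pMl ?sqnorm_gt0.
Qed.

(** The factor in front is unimodular and independent of [z], so it can be pulled out of a sum over
    the points. *)
Lemma blaschke_comp c d z : sqnorm c < 1 -> sqnorm d < 1 -> sqnorm z < 1 ->
  blaschke (blaschke c d) (blaschke c z) =
  - ((1 - d^* * c) / (1 - c^* * d)) * blaschke d z.
Proof.
move=> c1 d1 z1.
have cz := one_sub_conjM_neq0 (ltW c1) z1.
have cd := one_sub_conjM_neq0 (ltW c1) d1.
have dc := one_sub_conjM_neq0 (ltW d1) c1.
have cc := one_sub_conjM_neq0 (ltW c1) c1.
have dz := one_sub_conjM_neq0 (ltW d1) z1.
rewrite /blaschke fmorph_div !rmorphB rmorph1 rmorphM /= conjCK.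
field; apply/and5P; split=> //; first by rewrite mulrC.
(* The cleared denominator of the outer map factors into nonzero terms; treating conjugates as free
   variables makes this a [ring] identity. *)
suff -> : forall c' d', (1 - c * d') * (1 - c' * z) - (c' - d') * (c - z) =
    (1 - c' * c) * (1 - d' * z) by rewrite mulf_neq0.
by move=> c' d'; ring.
Qed.

End DiscBalancing.

Theorem theorem1p4 (R : realType) (N : nat) (hN : (1 <= N)%N)
    (zeta : 'I_N -> R[i]) (hzeta : forall k, unit_disc (zeta k)) :
  exists c : R[i],
    [/\ unit_disc c,
        forall theta : R, 0 <= theta < 2 * pi ->
          \sum_(k < N) mobius theta c (zeta k) = 0
      & forall (c' : R[i]) (theta : R),
          unit_disc c' -> 0 <= theta < 2 * pi ->
          \sum_(k < N) mobius theta c' (zeta k) = 0 -> c' = c].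
Proof.
have zeta1 k : sqnorm (zeta k) < 1 by apply/unit_discE.
have [c c1 cmax] := exists_potential_max zeta1 hN.
have c0 : \sum_k blaschke c (zeta k) = 0 := potential_max_critical zeta1 c1 cmax.
exists c; split => [|theta _|d theta /unit_discE d1 _].
- exact/unit_discE.
- by rewrite -mulr_sumr c0 mulr0.
rewrite -mulr_sumr => /eqP; rewrite mulf_eq0 -sqnorm_eq0.
have -> : sqnorm (expi theta) = 1 by rewrite /sqnorm /= cos2Dsin2.
rewrite oner_eq0 /= => /eqP d0.
(* The points [blaschke c (zeta k)] are balanced, and remain so under the map with parameter
   [blaschke c d]. *)
have /eqP : blaschke c d = 0.
  apply: (@balanced_unique _ _ (fun k => blaschke c (zeta k))) => //.
  - by move=> k; exact: sqnorm_blaschke_lt1.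
  - exact: sqnorm_blaschke_lt1.
  under eq_bigr do rewrite -/(blaschke _ _) blaschke_comp//.
  by rewrite -mulr_sumr d0 mulr0.
rewrite mulf_eq0 invr_eq0 (negPf (one_sub_conjM_neq0 (ltW c1) d1)) orbF.
by rewrite subr_eq0 => /eqP.
Qed.
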